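(* Let $k$ be a field, $S=k[x_1,\ldots,x_n]$, $d\ge 2$ an integer. Let $u=x_1^{a_1}\cdots x_n^{a_n}$ and $v=x_1^{b_1}\cdots x_n^{b_n}$ be monomials of degree $d$ with $u\ge_{lex}v$, and let $I=(\mathcal L(u,v))$ be a completely lexsegment ideal which has a linear resolution. Then the decomposition function $g:M(I)\to G(I)$ associated to the ordering $\prec$ of the generators from $G(I)$ is regular, that is, $\mathrm{set}(g(x_sw))\subseteq\mathrm{set}(w)$ for all $w\in G(I)$ and all $s\in\mathrm{set}(w)$.
   Context: Lexicographic order is taken with $x_1>\cdots>x_n$. $\mathcal M_d$ is the set of monomials of degree $d$ of $S$ and $\mathcal L(u,v)=\{w\in\mathcal M_d: u\ge_{lex}w\ge_{lex}v\}$. The shadow of a set $\mathcal L$ of monomials is $\mathrm{Shad}(\mathcal L)=\{x_iw: w\in\mathcal L,\ 1\le i\le n\}$; $(\mathcal L(u,v))$ is a completely lexsegment ideal if all iterated shadows of $\mathcal L(u,v)$ are lexsegments (i.e. of the form $\mathcal L(u',v')$). An ideal $I$ generated in degree $d$ has a linear resolution if $\mathrm{Tor}_i^S(I,k)_{i+j}=0$ for all $i$ and all $j\ne d$. The total order $\prec$ on $\mathcal M_d$ is: for $w=x_1^{\alpha_1}\cdots x_n^{\alpha_n}$ and $w'=x_1^{\beta_1}\cdots x_n^{\beta_n}$, $w\prec w'$ if $\alpha_1<\beta_1$, or $\alpha_1=\beta_1$ and $w>_{lex}w'$. Write $G(I)=\mathcal L(u,v)=\{w_1,\ldots,w_r\}$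 with $w_1\prec\cdots\prec w_r$. (A completely lexsegment ideal with a linear resolution has linear quotients with respect to this order: each $(w_1,\ldots,w_{i-1}):w_i$ is generated by variables.) $\mathrm{set}(w_i)=\{j\in\{1,\ldots,n\}: x_j\in(w_1,\ldots,w_{i-1}):w_i\}$. $M(I)$ is the set of all monomials in $I$, and the decomposition function $g:M(I)\to G(I)$ is $g(m)=w_j$, where $j$ is the smallest index with $m\in(w_1,\ldots,w_j)$. *)

(* Defs.v *)
From HB Require Import structures.
From mathcomp Require Import all_boot all_order all_algebra.
From mathcomp Require Import mpoly.
From mathcomp Require Import boolp. (* for [< P >] only *)

Set Implicit Arguments.
Unset Strict Implicit.
Unset Printing Implicit Defensive.

Import Order.TTheory GRing.Theory Num.Theory.
Local Open Scope ring_scope.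

(* Monomials are exponent vectors 'X_{1..n}.  Variables are indexed from 0: the
   variable written x_1 on paper, the largest one, has index ord0. *)

Section Monomials.
Variable n : nat.
Implicit Types (m u v w : 'X_{1..n}).

(* The pure lexicographic order with x_1 > ... > x_n.  The library's order on
   'X_{1..n} compares total degrees first, so it is not used here. *)
Definition lexlt w w' : bool :=
  [exists i : 'I_n, (w i < w' i)%N && [forall j : 'I_n, (j < i)%N ==> (w j == w' j)]].

Definition lexle w w' : bool := (w == w') || lexlt w w'.

Definition monomials (d : nat) : seq 'X_{1..n} :=
  [seq w <- [seq bmnm m | m : 'X_{1..n < d.+1}] | mdeg w == d].

Definition lexseg (d : nat) u v : seq 'X_{1..n} :=
  [seq w <- monomials d | lexle v w && lexle w u].

Lemma mem_monomials d w : (w \in monomials d) = (mdeg w == d).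
Proof.
rewrite mem_filter andb_idr // => /eqP hw.
have lt_w : (mdeg w < d.+1)%N by rewrite hw.
by apply/imageP; exists (BMultinom lt_w).
Qed.

Lemma mem_lexseg d u v w :
  (w \in lexseg d u v) = [&& mdeg w == d, lexle v w & lexle w u].
Proof. by rewrite mem_filter mem_monomials andbC. Qed.

Definition shadow (L : seq 'X_{1..n}) : seq 'X_{1..n} :=
  [seq (U_(i) + w)%MM | w <- L, i <- enum 'I_n].

Definition completely_lexsegment (d : nat) u v : Prop :=
  forall t : nat, exists u' v' : 'X_{1..n},
    [/\ mdeg u' = (d + t)%N, mdeg v' = (d + t)%N
      & iter t shadow (lexseg d u v) =i lexseg (d + t) u' v'].

End Monomials.

Section Order.
Variable n : nat.
Implicit Types (u v w : 'X_{1..n.+1}).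

Definition prec w w' : bool :=
  (w ord0 < w' ord0)%N || (w ord0 == w' ord0) && lexlt w' w.

Definition preceq w w' : bool := (w == w') || prec w w'.

(* w_1, ..., w_r : the elements of L(u,v), listed increasingly for prec. *)
Definition lexgens (d : nat) u v : seq 'X_{1..n.+1} :=
  sort preceq (lexseg d u v).

End Order.

Section Ideals.
Variables (k : fieldType) (n : nat).
Local Notation S := {mpoly k[n]}.

Definition mon_ideal (G : seq 'X_{1..n}) (p : S) : Prop :=
  exists c : 'I_(size G) -> S, p = \sum_i c i * 'X_[tnth (in_tuple G) i].

Definition colon (J : S -> Prop) (f : S) (p : S) : Prop := J (p * f).

(* For a list of generators ws = [:: w_1; ...; w_r]. *)
Definition setw (ws : seq 'X_{1..n}) (w : 'X_{1..n}) : {set 'I_n} :=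
  [set j | `[< colon (mon_ideal (take (index w ws) ws)) 'X_[w] 'X_j >]].

(* The defining property only concerns the monomials of the ideal (ws); the
   value at any other monomial is the junk value 0%MM. *)
Definition decomposition (ws : seq 'X_{1..n}) (m : 'X_{1..n}) : 'X_{1..n} :=
  nth 0%MM ws
    (find (fun j => `[< mon_ideal (take j.+1 ws) 'X_[m] >]) (iota 0 (size ws))).

Definition regular_decomposition (ws : seq 'X_{1..n}) : Prop :=
  forall w, w \in ws -> forall s, s \in setw ws w ->
    setw ws (decomposition ws (U_(s) + w)%MM) \subset setw ws w.

(* A graded free resolution
     ... -> F_2 -> F_1 -> F_0 -> I -> 0,   F_i = \bigoplus_l S(- fr_deg i l),
   by free modules of finite rank.  Elements of F_i are row vectors and maps act
   by right multiplication; they are homogeneous of degree 0. *)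
Record graded_free_resolution (I : S -> Prop) := GradedFreeResolution {
  fr_rank : nat -> nat;
  fr_deg  : forall i, 'I_(fr_rank i) -> int;
  fr_aug  : 'cV[S]_(fr_rank 0);
  fr_diff : forall i, 'M[S]_(fr_rank i.+1, fr_rank i);
  fr_aug_homog : forall l m,
    m \in msupp (fr_aug l ord0) -> (mdeg m)%:Z = fr_deg l;
  fr_diff_homog : forall i l l' m,
    m \in msupp (fr_diff i l l') -> (mdeg m)%:Z + fr_deg l' = fr_deg l;
  fr_aug_image : forall p : S,
    I p <-> exists x : 'rV[S]_(fr_rank 0), x *m fr_aug = p%:M;
  fr_exact0 : forall x : 'rV[S]_(fr_rank 0),
    x *m fr_aug = 0 <-> exists y, x = y *m fr_diff 0;
  fr_exactS : forall i (x : 'rV[S]_(fr_rank i.+1)),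
    x *m fr_diff i = 0 <-> exists y, x = y *m fr_diff i.+1
}.

Section Tor.
Variables (I : S -> Prop) (F : graded_free_resolution I).

(* F (x)_S k, where k = S / (x_1, ..., x_n): matrices are reduced to their
   constant terms. *)
Definition fr_diffk i : 'M[k]_(fr_rank F i.+1, fr_rank F i) :=
  map_mx (mcoeff 0%MM) (fr_diff F i).

Definition fr_in_degree i (q : int) (x : 'rV[k]_(fr_rank F i)) : Prop :=
  forall l, x ord0 l != 0 -> fr_deg (g := F) l = q.

Definition fr_cycle i : 'rV[k]_(fr_rank F i) -> Prop :=
  match i with
  | 0 => fun _ => True
  | j.+1 => fun x => x *m fr_diffk j = 0
  end.

Definition fr_homology_vanishes i (q : int) : Prop :=
  forall x : 'rV[k]_(fr_rank F i), fr_in_degree q x -> fr_cycle x ->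
    exists2 y : 'rV[k]_(fr_rank F i.+1), fr_in_degree q y & x = y *m fr_diffk i.

End Tor.

(* Tor_i^S(I, k)_q = 0.  Tor does not depend on the resolution used. *)
Definition tor_vanishes (I : S -> Prop) (i : nat) (q : int) : Prop :=
  exists F : graded_free_resolution I, fr_homology_vanishes F i q.

Definition linear_resolution (I : S -> Prop) (d : nat) : Prop :=
  forall (i : nat) (j : int), j != d%:Z -> tor_vanishes I i (i%:Z + j).

End Ideals.

(* Main.v *)
Require Import Defs.
From HB Require Import structures.
From mathcomp Require Import all_boot all_order all_algebra.
From mathcomp Require Import mpoly.
From mathcomp Require Import boolp ring zify.

Set Implicit Arguments.
Unset Strict Implicit.
Unset Printing Implicit Defensive.

Import Order.TTheory GRing.Theory Num.Theory.
Local Open Scope ring_scope.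

(* For w in L(u,v), set(w) consists of the j <> 1 such that some x_j w / x_t
   lies in L(u,v), with t = 1 or j < t.  If set(w) contains every j <> 1 that
   precedes some variable of w, regularity is a short exchange argument.

   Suppose such a j, preceding x_t | w, is not in set(w), and put
   y = x_j w / x_t.  Then y > u and u, w, y have the same x_1-exponent a, so by
   completeness x_i y is in the shadow of L(u,v) for every i <> 1.  If a = b_1,
   taking i = 2 gives a generator >= y > u, a contradiction.  Otherwise write
   y = x_1 m; then x_1 m and x_t m = x_j w / x_1 are not in I, while x_1 x_i m is
   in I for every i <> 1.  The boundary of x_1 m e_{2..n} is thus a Koszul cycle
   over I of degree d + n, whose class in Tor_{n-2}(I,k) is nonzero (compare the
   coefficients of m in the faces missing x_1 and x_t), so the resolution is not
   linear.  Tor is transferred from a free resolution to the Koszul complex by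
   the usual chase in the double complex. *)

(** * Exactness of the Koszul complex *)

Section DivideByVariable.
Variables (k : fieldType) (n : nat).
Local Notation S := {mpoly k[n]}.
Implicit Types (p q : S) (m : 'X_{1..n}) (i j : 'I_n).

Lemma mcoeffMX_if p m m' :
  (p * 'X_[m])@_m' = if (m <= m')%MM then p@_(m' - m) else 0.
Proof.
case: ifP => [le_mm'|/negP nle_mm'].
  by rewrite -{1}(submK le_mm') addmC mcoeffMX.
apply: memN_msupp_eq0; rewrite (perm_mem (msuppMX _ _)).
by apply/mapP => -[m'' _ e]; apply: nle_mm'; rewrite e lem_addr.
Qed.

(** Terms free of x_i are filtered out because truncated subtraction on exponents would keep
    them. *)
Definition mdivX i p : S :=
  \sum_(m <- msupp p | (0 < m i)%N) p@_m *: 'X_[m - U_(i)].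

Lemma lep1mE i m : (U_(i) <= m)%MM = (0 < m i)%N.
Proof.
apply/mnm_lepP/idP => [/(_ i)|m_gt0 j]; first by rewrite mnm1E eqxx.
by rewrite mnm1E; case: eqP => // <-.
Qed.

Lemma mcoeff_mdivX i p m : (mdivX i p)@_m = p@_(U_(i) + m).
Proof.
rewrite /mdivX raddf_sum /=.
have E m' : (0 < m' i)%N ->
    (p@_m' *: 'X_[m' - U_(i)])@_m = p@_m' * (m' == (U_(i) + m)%MM)%:R.
  rewrite -lep1mE => le_m'; rewrite mcoeffZ mcoeffX; congr (_ * (_)%:R).
  congr nat_of_bool; apply/eqP/eqP => [<-|->]; first by rewrite addmC submK.
  by rewrite addmC addmK.
rewrite (eq_bigr _ E); have [in_m|notin_m] := boolP ((U_(i) + m)%MM \in msupp p).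
  rewrite big_mkcond (bigD1_seq _ in_m) ?msupp_uniq //= mnmDE mnm1E !eqxx mulr1.
  by rewrite big1 ?addr0 // => m' /negPf ->; rewrite mulr0 if_same.
rewrite (memN_msupp_eq0 notin_m) big_seq_cond big1 // => m' /andP[m'p _].
by case: eqP => [e|_]; [rewrite -e m'p in notin_m | rewrite mulr0].
Qed.

Lemma mdivX_is_zmod_morphism i : zmod_morphism (mdivX i).
Proof. by move=> p q; apply/mpolyP => m; rewrite !(mcoeffB, mcoeff_mdivX). Qed.

HB.instance Definition _ i :=
  GRing.isZmodMorphism.Build S S (mdivX i) (mdivX_is_zmod_morphism i).

Lemma mdivX_sign i (b : nat) p : mdivX i ((-1) ^+ b * p) = (-1) ^+ b * mdivX i p.
Proof. by rewrite -signr_odd; case: (odd b); rewrite /= ?expr1 ?mulN1r ?raddfN // !mul1r. Qed.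

Lemma mdivXX i p : mdivX i ('X_i * p) = p.
Proof. by apply/mpolyP => m; rewrite mcoeff_mdivX mulrC mcoeffMX. Qed.

Lemma mdivXXC i j p : i != j -> mdivX i ('X_j * p) = 'X_j * mdivX i p.
Proof.
move=> ij; apply/mpolyP => m; rewrite mcoeff_mdivX ['X_j * p]mulrC.
rewrite ['X_j * mdivX i p]mulrC !mcoeffMX_if.
rewrite !lep1mE mnmDE mnm1E (negPf ij) add0n; case: ifP => // m_gt0.
rewrite mcoeff_mdivX; congr (_@__); apply/mnmP => l.
rewrite !(mnmDE, mnmBE) !mnm1E; case: eqP => [<-|_]; rewrite ?add0n ?addn0 ?subn0 //.
by rewrite [j == i]eq_sym (negPf ij) !subn0.
Qed.

Lemma mcoeff_subXdivX i p m :
  (p - 'X_i * mdivX i p)@_m = if (0 < m i)%N then 0 else p@_m.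
Proof.
rewrite mcoeffB mulrC mcoeffMX_if lep1mE; case: ifP => m_gt0; last by rewrite subr0.
by rewrite mcoeff_mdivX addmC submK ?lep1mE // subrr.
Qed.

End DivideByVariable.

Section Koszul.
Variables (k : fieldType) (n : nat).
Local Notation S := {mpoly k[n]}.
Local Notation T := {set 'I_n}.
Implicit Types (f g : T -> S) (s t : T) (i j : 'I_n).

(** For [i] outside [s], [(-1) ^+ ksgn i s] is the sign of sorting the wedge of e_i with e_s. *)
Definition ksgn i s : nat := #|[set j in s | (j < i)%N]|.

Lemma ksgnU i j s : j \notin s -> ksgn i (j |: s) = ((j < i) + ksgn i s)%N.
Proof.
move=> js; rewrite /ksgn; have [ji|ij] := boolP (j < i)%N.
  have -> : [set l in j |: s | (l < i)%N] = j |: [set l in s | (l < i)%N].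
    by apply/setP => l; rewrite !inE; case: eqP => // ->.
  by rewrite cardsU1 !inE (negPf js).
rewrite add0n; apply: eq_card => l; rewrite !inE; case: eqP => // ->.
by rewrite (negPf ij) (negPf js).
Qed.

Lemma signr_oddN (a b : nat) : odd a = ~~ odd b -> (-1) ^+ a = - (-1) ^+ b :> S.
Proof.
move=> ab; rewrite -(signr_odd _ a) -(signr_odd _ b) ab; case: (odd b) => /=.
  by rewrite expr0 expr1 opprK.
by rewrite expr0 expr1.
Qed.

(** Exactly one of i < j and j < i holds, so exactly one of the two counts grows. This parity drives
    both the square-zero identity and the homotopy identity. *)
Lemma ksgn_swap i j s : i \notin s -> j \notin s -> i != j ->
  odd (ksgn i (j |: s) + ksgn j (i |: s)) = ~~ odd (ksgn i s + ksgn j s).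
Proof.
move=> i_s j_s ij; rewrite !ksgnU // !oddD.
case: (ltngtP i j) => [||/val_inj e]; last by rewrite e eqxx in ij.
  by move=> _ /=; do 2 case: (odd _).
by move=> _ /=; do 2 case: (odd _).
Qed.

(* An element of the Koszul complex is the family of its coefficients on the
   basis e_s, s a set of variables; all exterior degrees are kept together. *)
Definition kosz f s : S :=
  \sum_(i | i \notin s) (-1) ^+ ksgn i s * ('X_i * f (i |: s)).

Lemma eq_kosz f g : f =1 g -> kosz f =1 kosz g.
Proof. by move=> fg s; apply: eq_bigr => i _; rewrite fg. Qed.

Lemma koszB f g s : kosz (fun t => f t - g t) s = kosz f s - kosz g s.
Proof. by rewrite /kosz -sumrB; apply: eq_bigr => i _; rewrite !mulrBr. Qed.

Lemma koszD f g s : kosz (fun t => f t + g t) s = kosz f s + kosz g s.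
Proof. by rewrite /kosz -big_split; apply: eq_bigr => i _; rewrite !mulrDr. Qed.

Lemma koszMr f a s : kosz (fun t => f t * a) s = kosz f s * a.
Proof. by rewrite /kosz mulr_suml; apply: eq_bigr => i _; rewrite !mulrA. Qed.

Lemma kosz_sum (I : finType) (F : I -> T -> S) s :
  kosz (fun t => \sum_l F l t) s = \sum_l kosz (F l) s.
Proof.
rewrite /kosz exchange_big; apply: eq_bigr => i _; rewrite !mulr_sumr.
by apply: eq_bigr.
Qed.

Lemma kosz_kosz f s : kosz (kosz f) s = 0.
Proof.
rewrite /kosz.
pose a i j := (-1) ^+ ksgn i s * ('X_i * ((-1) ^+ ksgn j (i |: s) *
   ('X_j * f (j |: (i |: s))))).
pose P i j := [&& i \notin s, j \notin s & i != j].
have -> : \sum_(i | i \notin s) (-1) ^+ ksgn i s * ('X_i *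
   \sum_(j | j \notin i |: s) (-1) ^+ ksgn j (i |: s) * ('X_j * f (j |: (i |: s))))
   = \sum_i \sum_(j | P i j) a i j.
  rewrite big_mkcond; apply: eq_bigr => i _; rewrite /P; case: (i \notin s) => /=.
    rewrite !mulr_sumr; apply: eq_bigl => j; rewrite !inE negb_or eq_sym.
    by rewrite andbC.
  by rewrite big_pred0.
have antisym i j : P i j -> a i j = - a j i.
  move=> /and3P[i_s j_s ij]; rewrite /a.
  have -> : i |: (j |: s) = j |: (i |: s) by rewrite setUCA.
  rewrite ['X_i * (_ * _)]mulrCA ['X_j * (_ * _)]mulrCA ['X_i * ('X_j * _)]mulrCA.
  rewrite !mulrA -!exprD (@signr_oddN _ (ksgn j s + ksgn i (j |: s))) ?mulNr //.
  by move: (ksgn_swap i_s j_s ij); rewrite !oddD; do 4 case: (odd _).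
(* Split the pairs along i < j and reflect the other half, so that opposite terms meet. *)
rewrite pair_big_dep /= (bigID (fun p : 'I_n * 'I_n => (p.1 < p.2)%N)) /=.
rewrite [X in _ + X](reindex_inj (h := fun p : 'I_n * 'I_n => (p.2, p.1))) /=; last first.
  by move=> [x y] [x' y'] [-> ->].
have -> : \sum_(p | P p.2 p.1 && ~~ (p.2 < p.1)%N) a p.2 p.1 =
    \sum_(p | P p.1 p.2 && (p.1 < p.2)%N) a p.2 p.1.
  apply: eq_bigl => -[i j] /=; rewrite /P /= [j == i]eq_sym -leqNgt leq_eqVlt.
  have [->|ij] := eqVneq i j; first by rewrite !andbF.
  by rewrite (inj_eq val_inj) (negPf ij) !andbT [(j \notin s) && _]andbC.
rewrite -big_split big1 // => p /andP[Pp _] /=.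
by rewrite antisym // addNr.
Qed.

(* Homotopy operator attached to one variable: kosz h_i + h_i kosz is the
   identity minus the projection onto the terms x^m e_s not involving x_i. *)
Definition khom i f s : S :=
  if i \in s then (-1) ^+ ksgn i (s :\ i) * mdivX i (f (s :\ i)) else 0.

(** Only the summand adding [i] reaches a set containing [i]; elsewhere [khom i f] vanishes. *)
Lemma kosz_khom_notin i f s : i \notin s ->
  kosz (khom i f) s = 'X_i * mdivX i (f s).
Proof.
move=> i_s; rewrite /kosz (bigD1 i) //= big1 ?addr0.
  by rewrite /khom setU11 setU1K // mulrCA signrMK.
move=> j /andP[j_s ji]; rewrite /khom !inE eq_sym (negPf ji) (negPf i_s) /=.
by rewrite !mulr0.
Qed.

(** Apply [mdivX i] to the cycle equation at [s :\ i]: the summand of x_i becomes [f s] up to sign,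
    and by [ksgn_swap] the others are the summands of the boundary of [khom i f]. *)
Lemma kosz_khom_in i f s : (forall t, kosz f t = 0) -> i \in s ->
  kosz (khom i f) s = f s.
Proof.
move=> f0 i_s; set r := s :\ i; have i_r : i \notin r by rewrite !inE eqxx.
have sE : s = i |: r by rewrite setD1K.
have := f0 r; rewrite /kosz (bigD1 i) //= -sE => /(congr1 (mdivX i)).
rewrite raddf0 raddfD /= mdivX_sign mdivXX => /eqP; rewrite addr_eq0 => /eqP e.
rewrite -[RHS](signrMK (ksgn i r)) e mulrN raddf_sum mulr_sumr -sumrN.
rewrite /kosz; apply: eq_big => j.
  by rewrite sE !inE negb_or andbC.
move=> j_s; have j_r : j \notin r by apply: contra j_s; rewrite inE => /andP[].
have ij : i != j by apply: contraNneq j_s => <-.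
rewrite /khom !inE i_s orbT /= mdivX_sign mdivXXC //.
have -> : (j |: s) :\ i = j |: r.
  by apply/setP => l; rewrite !inE; case: eqP => //= ->; rewrite (negPf ij).
rewrite ['X_j * (_ * _)]mulrCA !mulrA -!exprD.
rewrite (@signr_oddN _ (ksgn i r + ksgn j r)) ?mulNr //.
by move: (ksgn_swap i_r j_r ij); rewrite -sE !oddD; do 4 case: (odd _).
Qed.

Lemma mcoeff0_kosz f s : (kosz f s)@_0 = 0.
Proof.
rewrite /kosz raddf_sum /= big1 // => i _; rewrite mulrCA mulrC mcoeffMX_if.
by rewrite lep1mE mnm0E.
Qed.

(** Using the homotopies one variable at a time, f is changed by boundaries until no term involves
    any x_i or e_i. What remains is a constant at the empty set, which is 0 by assumption. *)
Lemma kosz_exact f : (forall s, kosz f s = 0) -> (f set0)@_0 = 0 ->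
  exists g, forall s, f s = kosz g s.
Proof.
move=> f_cycle f0.
pose free (h : T -> S) i := forall s (m : 'X_{1..n}),
  (i \in s) || (0 < m i)%N -> (h s)@_m = 0.
have reduce (r : seq 'I_n) : exists g, forall i, i \in r ->
    free (fun s => f s - kosz g s) i.
  elim: r => [|i r [g gP]]; first by exists (fun=> 0).
  pose f' s := f s - kosz g s.
  have f'_cycle s : kosz f' s = 0 by rewrite koszB f_cycle kosz_kosz subr0.
  exists (fun s => g s + khom i f' s) => j j_ir s m.
  rewrite koszD opprD addrA -/(f' s).
  have [i_s|i_s] := boolP (i \in s).
    by rewrite kosz_khom_in // subrr mcoeff0.
  (* The correction for x_i only deletes coefficients of [f'], so the variables treated earlier stay
     absent. *)
  rewrite kosz_khom_notin // mcoeff_subXdivX.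
  case: ifP => // m_i; move: j_ir; rewrite inE; case: eqP => [->|_ /= j_r].
    by rewrite m_i (negPf i_s).
  exact: gP.
have [g gP] := reduce (enum 'I_n); exists g => s.
apply/eqP; rewrite -subr_eq0; apply/eqP/mpolyP => m; rewrite mcoeff0.
have [/existsP[i im]|nim] := boolP [exists i, (i \in s) || (0 < m i)%N].
  by apply: gP im; rewrite mem_enum.
have s0 : s = set0.
  by apply/setP => i; rewrite inE; apply: contraNF nim => i_s; apply/existsP; exists i; rewrite i_s.
have m0 : m = 0%MM.
  apply/mnmP => i; rewrite mnm0E; apply/eqP; rewrite -leqn0 leqNgt.
  by apply: contra nim => mi; apply/existsP; exists i; rewrite mi orbT.
by rewrite s0 m0 mcoeffB f0 mcoeff0_kosz subr0.
Qed.

End Koszul.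

(** * Gradings on the Koszul complex of a free module *)

Section HomogeneousComponent.
Variables (k : fieldType) (n : nat).
Local Notation S := {mpoly k[n]}.
Implicit Types (p q : S) (m : 'X_{1..n}) (e : int).

(** The degree is an integer since it is computed from twists of a resolution; for negative [e] the
    component is 0. *)
Definition hcomp e p : S := \sum_(m <- msupp p | (mdeg m)%:Z == e) p@_m *: 'X_[m].

Lemma mcoeff_hcomp e p m : (hcomp e p)@_m = if (mdeg m)%:Z == e then p@_m else 0.
Proof.
rewrite /hcomp raddf_sum /= big_mkcond /=.
have [m_p|m_p] := boolP (m \in msupp p).
  rewrite (bigD1_seq _ m_p) ?msupp_uniq //= big1 ?addr0.
    by rewrite mcoeffZ mcoeffX eqxx mulr1.
  by move=> m' /negPf m'm; rewrite mcoeffZ mcoeffX m'm mulr0 if_same.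
rewrite (memN_msupp_eq0 m_p) if_same big_seq big1 // => m' m'_p.
have /negPf m'm : m' != m by apply: contraNneq m_p => <-.
by rewrite mcoeffZ mcoeffX m'm mulr0 if_same.
Qed.

Lemma hcomp_is_zmod_morphism e : zmod_morphism (hcomp e).
Proof.
move=> p q; apply/mpolyP => m; rewrite !(mcoeffB, mcoeff_hcomp).
by case: ifP; rewrite ?subr0.
Qed.

HB.instance Definition _ e :=
  GRing.isZmodMorphism.Build S S (hcomp e) (hcomp_is_zmod_morphism e).

Lemma hcomp_id e p : (forall m, m \in msupp p -> (mdeg m)%:Z = e) -> hcomp e p = p.
Proof.
move=> p_e; apply/mpolyP => m; rewrite mcoeff_hcomp; case: eqP => // m_e.
by rewrite memN_msupp_eq0 //; apply/negP => /p_e.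
Qed.

Lemma msupp_hcomp e p m : m \in msupp (hcomp e p) -> (mdeg m)%:Z = e.
Proof. by rewrite mcoeff_msupp mcoeff_hcomp; case: (_ =P e) => // _; rewrite eqxx. Qed.

Lemma hcompMX e p m : hcomp (e + (mdeg m)%:Z) (p * 'X_[m]) = hcomp e p * 'X_[m].
Proof.
apply/mpolyP => m'; rewrite mcoeff_hcomp !mcoeffMX_if mcoeff_hcomp.
case: (boolP (m <= m')%MM) => [le_mm'|_]; last by rewrite if_same.
by rewrite -{1}(submK le_mm') mdegD PoszD (inj_eq (addIr _)).
Qed.

Lemma hcompM e e' p q : (forall m, m \in msupp q -> (mdeg m)%:Z = e') ->
  hcomp (e + e') (p * q) = hcomp e p * q.
Proof.
move=> q_e'; rewrite [q]mpolyE !mulr_sumr raddf_sum big_seq [RHS]big_seq /=.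
apply: eq_bigr => m m_q; rewrite -(q_e' m m_q) -!scalerAr -hcompMX.
by apply/mpolyP => m'; rewrite !(mcoeff_hcomp, mcoeffZ); case: ifP; rewrite ?mulr0.
Qed.

End HomogeneousComponent.

Section GradedKoszul.
Variables (k : fieldType) (n : nat).
Local Notation S := {mpoly k[n]}.
Local Notation T := {set 'I_n}.
Implicit Types (s t : T) (p : nat) (q : int).

(* Elements of K (x) F, F free of rank r: families of row vectors indexed by
   the basis of the Koszul complex. *)
Definition koszr r (f : T -> 'rV[S]_r) s : 'rV[S]_r :=
  \row_l kosz (fun t => f t ord0 l) s.

Lemma koszrB r (f g : T -> 'rV[S]_r) s :
  koszr (fun t => f t - g t) s = koszr f s - koszr g s.
Proof.
apply/rowP => l; rewrite !mxE -koszB; apply: eq_kosz => t; by rewrite !mxE.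
Qed.

Lemma eq_koszr r (f g : T -> 'rV[S]_r) : f =1 g -> koszr f =1 koszr g.
Proof. by move=> fg s; apply/rowP => l; rewrite !mxE; apply: eq_kosz => t; rewrite fg. Qed.

Lemma koszr_koszr r (f : T -> 'rV[S]_r) s : koszr (koszr f) s = 0.
Proof.
by apply/rowP => l; rewrite !mxE -[RHS](kosz_kosz (fun t => f t ord0 l) s);
  apply: eq_kosz => t; rewrite mxE.
Qed.

Lemma koszr_mulmx r r' (f : T -> 'rV[S]_r) (A : 'M_(r, r')) s :
  koszr (fun t => f t *m A) s = koszr f s *m A.
Proof.
apply/rowP => l; rewrite !mxE.
rewrite (eq_kosz (g := fun t => \sum_j f t ord0 j * A j l)).
  by rewrite kosz_sum; apply: eq_bigr => j _; rewrite koszMr !mxE.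
by move=> t; rewrite mxE.
Qed.

Lemma koszr_exact r (f : T -> 'rV[S]_r) : (forall s, koszr f s = 0) ->
  (forall l, (f set0 ord0 l)@_0 = 0) -> exists g, forall s, f s = koszr g s.
Proof.
move=> f_cycle f0.
have /fin_all_exists [g gP] l :
    exists g, forall s, f s ord0 l = kosz g s.
  by apply: kosz_exact => // s; have /rowP/(_ l) := f_cycle s; rewrite !mxE.
exists (fun s => \row_l g l s) => s; apply/rowP => l; rewrite mxE gP.
by apply: eq_kosz => t; rewrite mxE.
Qed.

Section Projection.
Variables (q : int) (r : nat) (deg : 'I_r -> int).
Implicit Types (f g : T -> 'rV[S]_r).

(** The basis element e_s counts with internal degree [#|s|], so the boundary preserves [q] and
    lowers [p]. *)
Definition khomog p f := forall s l m, m \in msupp (f s ord0 l) ->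
  #|s| = p /\ (mdeg m)%:Z + p%:Z + deg l = q.

Definition kproj p f s : 'rV[S]_r :=
  \row_l (if #|s| == p then hcomp (q - p%:Z - deg l) (f s ord0 l) else 0).

Lemma kproj_homog p f : khomog p (kproj p f).
Proof.
move=> s l m; rewrite mxE; case: eqP => [sp|_]; last by rewrite msupp0.
by move=> /msupp_hcomp ->; rewrite addrAC !subrK.
Qed.

Lemma kproj_id p f : khomog p f -> kproj p f =1 f.
Proof.
move=> fp s; apply/rowP => l; rewrite mxE; case: eqP => sp.
  by rewrite hcomp_id // => m /fp [_ <-]; rewrite addrAC addrK addrK.
by apply/esym/msuppnil0; case E: (msupp _) => [//|m ms]; have := fp s l m;
  rewrite E mem_head => /(_ isT) [].
Qed.

Lemma eq_kproj p f g : f =1 g -> kproj p f =1 kproj p g.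
Proof. by move=> fg s; apply/rowP => l; rewrite !mxE fg. Qed.

Lemma khomogB p f g : khomog p f -> khomog p g -> khomog p (fun s => f s - g s).
Proof.
move=> fp gp s l m; rewrite !mxE => /msuppB_le; rewrite mem_cat.
by case/orP => [/fp|/gp].
Qed.

(** Multiplication by x_i raises the polynomial degree by one, which makes up for the vertex
    lost. *)
Lemma koszr_kproj p f s : koszr (kproj p.+1 f) s = kproj p (koszr f) s.
Proof.
apply/rowP => l; rewrite !mxE /kosz; case: eqP => sp.
  rewrite raddf_sum /=; apply: eq_bigr => i i_s.
  rewrite !mxE cardsU1 i_s sp add1n eqxx -[in RHS]signr_odd -[in LHS]signr_odd.
  have E (b : bool) (x : S) (e : int) : hcomp e ((-1) ^+ b * x) = (-1) ^+ b * hcomp e x.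
    by rewrite !mulr_sign; case: b; rewrite ?raddfN.
  rewrite E; congr (_ * _); rewrite mulrC [in RHS]mulrC -hcompMX mdeg1.
  by congr (hcomp _ _); rewrite intS; ring.
rewrite big1 // => i i_s; rewrite mxE cardsU1 i_s add1n eqSS.
by case: eqP => //; rewrite !mulr0.
Qed.

Lemma koszr_homog p f : khomog p.+1 f -> khomog p (koszr f).
Proof.
move=> fp s l m; rewrite -(eq_koszr (kproj_id fp)) koszr_kproj.
exact: kproj_homog.
Qed.

End Projection.

Section Change.
Variables (q : int) (r r' : nat) (deg : 'I_r -> int) (deg' : 'I_r' -> int).
Variable (A : 'M[S]_(r, r')).
Hypothesis A_homog : forall l l' m,
  m \in msupp (A l l') -> (mdeg m)%:Z + deg' l' = deg l.

Lemma kproj_mulmx p (f : T -> 'rV[S]_r) s :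
  kproj q deg p f s *m A = kproj q deg' p (fun t => f t *m A) s.
Proof.
apply/rowP => l; rewrite !mxE; case: eqP => sp.
  rewrite raddf_sum /=; apply: eq_bigr => j _; rewrite mxE sp eqxx.
  rewrite -(hcompM _ _ (e' := deg j - deg' l)).
    by congr (hcomp _ _); ring.
  by move=> m /A_homog <-; rewrite addrK.
by rewrite big1 // => j _; rewrite mxE; case: eqP => //; rewrite mul0r.
Qed.

Lemma mulmx_homog p (f : T -> 'rV[S]_r) : khomog q deg p f ->
  khomog q deg' p (fun t => f t *m A).
Proof.
move=> fp s l m.
rewrite -(kproj_id fp s) kproj_mulmx; exact: kproj_homog.
Qed.

End Change.
End GradedKoszul.

(** * Tor and Koszul homology *)

Section KoszulTor.
Variables (k : fieldType) (n : nat).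
Local Notation S := {mpoly k[n]}.
Local Notation T := {set 'I_n}.
Variables (I : S -> Prop) (F : graded_free_resolution I) (q : int).

(* The resolution augmented by S itself in position 0, the module F_r being
   shifted to position r.+1. *)
Definition aug_rank r : nat := if r is r'.+1 then fr_rank F r' else 1.

Definition aug_deg r : 'I_(aug_rank r) -> int :=
  if r is r'.+1 then @fr_deg _ _ _ F r' else fun=> 0.

Definition aug_diff r : 'M[S]_(aug_rank r.+1, aug_rank r) :=
  if r is r'.+1 then fr_diff F r' else fr_aug F.

Lemma aug_diff_homog r l l' m :
  m \in msupp (aug_diff r l l') -> (mdeg m)%:Z + aug_deg l' = aug_deg l.
Proof.
case: r l l' => [|r] l l' /=; last exact: fr_diff_homog.
by rewrite [l']ord1 addr0; apply: fr_aug_homog.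
Qed.

Lemma aug_diff_exact r (x : 'rV_(aug_rank r.+1)) :
  x *m aug_diff r = 0 <-> exists y, x = y *m aug_diff r.+1.
Proof. by case: r x => [|r] x; [apply: fr_exact0 | apply: fr_exactS]. Qed.

Lemma aug_diff_diff r (x : 'rV_(aug_rank r.+2)) :
  x *m aug_diff r.+1 *m aug_diff r = 0.
Proof. by apply/aug_diff_exact; exists x. Qed.

(* Vanishing in degree q of the kernel of
   H_p(K (x) Z) -> H_p(K (x) F), Z the image of F' -> F, for F and F' in
   positions r and r.+1. *)
Definition kosz_lifts p r := forall c : T -> 'rV[S]_(aug_rank r),
  khomog q (@aug_deg r) p.+1 c ->
  (forall s, exists y, koszr c s = y *m aug_diff r) ->
  exists2 g : T -> 'rV[S]_(aug_rank r.+1), khomog q (@aug_deg r.+1) p.+1 g &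
    forall s, koszr (fun t => g t *m aug_diff r) s = koszr c s.

(** Preimages are chosen freely for each [s] and then projected; the projection commutes with the
    homogeneous matrix and fixes the boundary of [c]. *)
Lemma kosz_homog_lift p r (c : T -> 'rV[S]_(aug_rank r)) :
  khomog q (@aug_deg r) p.+1 c ->
  (forall s, exists y, koszr c s = y *m aug_diff r) ->
  exists2 b : T -> 'rV[S]_(aug_rank r.+1), khomog q (@aug_deg r.+1) p b &
    forall s, b s *m aug_diff r = koszr c s.
Proof.
move=> cp /fin_all_exists[b0 b0P].
exists (kproj q (@aug_deg r.+1) p b0); first exact: kproj_homog.
move=> s; rewrite (kproj_mulmx _ (@aug_diff_homog r)).
by rewrite -(eq_kproj _ _ _ b0P) (kproj_id (koszr_homog cp)).
Qed.

(** One step of the chase: lift the boundary of [c] to [c'], whose boundary lies in the next image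
    by exactness of the resolution. The hypothesis corrects [c'] to a Koszul cycle, which bounds
    some [g]; this [g] is the required lift of [c]. *)
Lemma kosz_lifts_step p r : kosz_lifts p r.+1 -> kosz_lifts p.+1 r.
Proof.
move=> Cpr c cp /(kosz_homog_lift cp)[c' c'p c'E].
have [||g' g'p g'E] := Cpr c'; first by [].
  move=> s; apply/aug_diff_exact; rewrite -koszr_mulmx (eq_koszr c'E).
  exact: koszr_koszr.
pose e s := c' s - g' s *m aug_diff r.+1.
have ep : khomog q (@aug_deg r.+1) p.+1 e.
  by apply: khomogB => //; apply: mulmx_homog g'p; apply: aug_diff_homog.
have [s|l|g0 g0E] := koszr_exact (f := e).
- by rewrite koszrB g'E subrr.
(* A chain of positive exterior degree is 0 at the empty set. *)
- apply: memN_msupp_eq0; apply/negP => /ep[].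
  by rewrite cards0.
pose g := kproj q (@aug_deg r.+1) p.+2 g0.
have gE s : koszr g s = e s.
  by rewrite koszr_kproj -(eq_kproj _ _ _ g0E) (kproj_id ep).
exists g; first exact: kproj_homog.
by move=> s; rewrite koszr_mulmx gE mulmxBl aug_diff_diff subr0 c'E.
Qed.

(** The lift [b] lives at the empty set, and its constant terms form a cycle of F tensored with k.
    Vanishing of homology allows these constants to be removed by an image of the next differential,
    after which [b] is a Koszul boundary. *)
Lemma kosz_lifts0 i : fr_homology_vanishes F i q -> kosz_lifts 0 i.
Proof.
move=> vanish c cp /(kosz_homog_lift cp)[b bp bE].
pose x := map_mx (mcoeff 0%MM) (b set0).
(* In positive position, [x] is sent to the constant terms of a Koszul boundary, hence to 0. *)
have x_cycle : fr_cycle (F := F) x.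
  case: i {vanish} c cp b bp bE @x => // j c cp b bp bE x /=.
  rewrite /x -map_mxM bE; apply/rowP => l; rewrite !mxE.
  exact: mcoeff0_kosz.
have x_deg : fr_in_degree (F := F) (i := i) q x.
  by move=> l; rewrite mxE -mcoeff_msupp => /bp[_]; rewrite mdeg0 !add0r.
have [y _ xE] := vanish x x_deg x_cycle.
pose b2 (s : T) : 'rV[S]_(aug_rank i.+2) :=
  if s == set0 then map_mx (@mpolyC n k) y else 0.
pose e s := b s - b2 s *m aug_diff i.+1.
have e0 s : s != set0 -> e s = 0.
  move=> s_n0; rewrite /e /b2 (negPf s_n0) mul0mx subr0; apply/rowP => l.
  rewrite mxE; apply/msuppnil0; case E: (msupp _) => [//|m ms].
  have := bp s l m; rewrite E mem_head => /(_ isT) [/eqP].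
  by rewrite cards_eq0 (negPf s_n0).
have [s|l|g0 g0E] := koszr_exact (f := e).
- apply/rowP => l; rewrite !mxE /kosz big1 // => j _.
  rewrite e0 ?mxE ?mulr0 //; apply/set0Pn; exists j; exact: setU11.
- have /rowP/(_ l) : map_mx (mcoeff 0%MM) (e set0) = 0.
    have yK : map_mx (mcoeff 0%MM) (map_mx (@mpolyC n k) y) = y.
      by apply/rowP => l'; rewrite !mxE mcoeffC eqxx mulr1.
    by rewrite /e /b2 eqxx raddfB /= map_mxM yK -/x xE subrr.
  by rewrite !mxE.
exists (kproj q (@aug_deg i.+1) 1 g0); first exact: kproj_homog.
move=> s; rewrite koszr_mulmx koszr_kproj (kproj_mulmx _ (@aug_diff_homog i)).
rewrite -(kproj_id (koszr_homog cp)); apply: eq_kproj => t.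
by rewrite -g0E /e mulmxBl aug_diff_diff subr0 bE.
Qed.

(** Moves along an antidiagonal of the double complex: exterior degree is traded for resolution
    degree until the Tor hypothesis applies. *)
Lemma kosz_lifts_all i : fr_homology_vanishes F i q ->
  forall p r, (p + r)%N = i -> kosz_lifts p r.
Proof.
move=> vanish; elim=> [|p IHp] r; first by rewrite add0n => ->; apply: kosz_lifts0.
by rewrite addSnnS => /IHp; apply: kosz_lifts_step.
Qed.

End KoszulTor.

(* Vanishing in degree q of the Koszul homology H_i(K; I), which is Tor_i(I, k),
   for cycles over I that are boundaries over S; if i > 0 all cycles are. *)
Lemma kosz_tor_vanishes (k : fieldType) n (I : {mpoly k[n]} -> Prop) (i : nat)
    (q : int) (c : {set 'I_n} -> {mpoly k[n]}) :
  tor_vanishes I i q ->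
  (forall s m, m \in msupp (c s) -> #|s| = i.+1 /\ (mdeg m)%:Z + i.+1%:Z = q) ->
  (forall s, I (kosz c s)) ->
  exists2 w, forall s, I (w s) & forall s, kosz w s = kosz c s.
Proof.
case=> F vanish c_homog c_I.
(* Position 0 of the augmented resolution is S, so polynomials become 1 by 1 rows and the image of
   [aug_diff F 0] is I. *)
have [||g _ gE] := kosz_lifts_all vanish (addn0 i) (c := fun s => (c s)%:M).
- by move=> s l m; rewrite mxE [l]ord1 eqxx addr0; apply: c_homog.
- move=> s; have [y yE] := (fr_aug_image F _).1 (c_I s); exists y.
  rewrite yE; apply/rowP => l; rewrite !mxE [l]ord1 eqxx.
  by apply: eq_kosz => t; rewrite mxE eqxx.
exists (fun s => (g s *m aug_diff F 0) ord0 ord0) => s.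
  apply/(fr_aug_image F); exists (g s); apply/rowP => l.
  by rewrite [RHS]mxE [l]ord1 eqxx.
have /rowP/(_ ord0) := gE s; rewrite !mxE => ->.
by apply: eq_kosz => t; rewrite mxE eqxx.
Qed.

(** * Monomial ideals and exchanges *)

Section MonomialIdeals.
Variables (k : fieldType) (n : nat).
Local Notation S := {mpoly k[n]}.
Implicit Types (G : seq 'X_{1..n}) (p q : S) (m g : 'X_{1..n}).

Lemma mon_ideal0 G : mon_ideal G (0 : S).
Proof. by exists (fun=> 0); rewrite big1 // => i _; rewrite mul0r. Qed.

Lemma mon_idealD G p q : mon_ideal G p -> mon_ideal G q -> mon_ideal G (p + q).
Proof.
move=> [c ->] [c' ->]; exists (fun i => c i + c' i).
by rewrite -big_split; apply: eq_bigr => i _; rewrite mulrDl.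
Qed.

Lemma mon_idealM G p q : mon_ideal G q -> mon_ideal G (p * q).
Proof.
move=> [c ->]; exists (fun i => p * c i).
by rewrite mulr_sumr; apply: eq_bigr => i _; rewrite mulrA.
Qed.

Lemma mon_idealX G m : has (fun g => (g <= m)%MM) G -> mon_ideal G ('X_[m] : S).
Proof.
case/hasP => g gG gm; have lt_g : (index g G < size G)%N by rewrite index_mem.
rewrite -(submK gm) mpolyXD; apply: mon_idealM.
exists (fun i => (i == Ordinal lt_g)%:R); rewrite (bigD1 (Ordinal lt_g)) //=.
rewrite eqxx mul1r big1 ?addr0 => [|i /negPf ->]; last by rewrite mul0r.
by rewrite (tnth_nth 0%MM) /= nth_index.
Qed.

Lemma msupp_mon_ideal G p m : mon_ideal G p -> m \in msupp p ->
  has (fun g => (g <= m)%MM) G.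
Proof.
case=> c -> m_supp; apply: contraTT m_supp => /hasPn noG.
rewrite -mcoeff_eq0 raddf_sum /= big1 // => i _; rewrite mcoeffMX_if ifF //.
by apply/negbTE/noG; exact: mem_tnth.
Qed.

Lemma mon_idealXE G m :
  mon_ideal G ('X_[m] : S) <-> has (fun g => (g <= m)%MM) G.
Proof.
split; last exact: mon_idealX.
by move=> /msupp_mon_ideal; apply; rewrite msuppX mem_seq1.
Qed.

End MonomialIdeals.

Section Lex.
Variable n : nat.
Implicit Types (u v w a b c m : 'X_{1..n}) (i j l : 'I_n).

Lemma addmCA a b c : (a + (b + c))%MM = (b + (a + c))%MM.
Proof. by rewrite !addmA [(a + b)%MM]addmC. Qed.

Lemma lexltP w w' : reflect
  (exists2 i : 'I_n, (w i < w' i)%N & forall j : 'I_n, (j < i)%N -> w j = w' j)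
  (lexlt w w').
Proof.
apply: (iffP existsP) => -[i].
  by case/andP => lt_i /forallP h; exists i => // j ji; apply/eqP/(implyP (h j)).
by move=> lt_i h; exists i; rewrite lt_i; apply/forallP => j; apply/implyP => /h ->.
Qed.

Lemma lexlt_irr w : lexlt w w = false.
Proof. by apply/lexltP => -[i]; rewrite ltnn. Qed.

Lemma lexlt_trans b a c : lexlt a b -> lexlt b c -> lexlt a c.
Proof.
case/lexltP => i ab abE /lexltP[j bc bcE]; apply/lexltP.
case: (ltngtP i j) => [ij|ji|/val_inj ij].
- by exists i => [|l li]; rewrite -?(bcE i) // abE // bcE // (ltn_trans li).
- by exists j => [|l lj]; rewrite ?(abE j) // abE ?bcE // (ltn_trans lj).
- subst j; exists i => [|l li]; first exact: ltn_trans bc.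
  by rewrite abE // bcE.
Qed.

Lemma lexlt_total a b : [|| a == b, lexlt a b | lexlt b a].
Proof.
have [//|ab /=] := eqVneq a b; have /existsP[i0 i0P] : [exists i, a i != b i].
  apply: contraR ab; rewrite negb_exists => /forallP h; apply/eqP/mnmP => i.
  by apply/eqP; have := h i; rewrite negbK.
case: (@arg_minnP _ i0 (fun i => a i != b i) val i0P) => i iP imin.
have eqi j : (j < i)%N -> a j = b j.
  by move=> ji; apply/eqP; apply: contraLR ji => /imin; rewrite -leqNgt.
case: (ltngtP (a i) (b i)) iP => // lt_i _; apply/orP; [left|right].
  by apply/lexltP; exists i.
by apply/lexltP; exists i => // j /eqi.
Qed.

Lemma lexlt_asym a b : lexlt a b -> lexlt b a = false.
Proof.
by move=> ab; apply/negbTE/negP => ba; have := lexlt_trans ab ba; rewrite lexlt_irr.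
Qed.

Lemma lexltNge a b : lexlt a b = ~~ lexle b a.
Proof.
rewrite /lexle; have [->|ab] := eqVneq b a; first by rewrite lexlt_irr.
have := lexlt_total a b; rewrite eq_sym (negPf ab) /=.
by case E: (lexlt a b); [rewrite (lexlt_asym E) | move=> /= ->].
Qed.

Lemma lexltW a b : lexlt a b -> lexle a b.
Proof. by rewrite /lexle => ->; rewrite orbT. Qed.

Lemma lexle_lt_trans b a c : lexle a b -> lexlt b c -> lexlt a c.
Proof. by case/orP => [/eqP->//|]; apply: lexlt_trans. Qed.

Lemma lexlt_le_trans b a c : lexlt a b -> lexle b c -> lexlt a c.
Proof. by move=> ab /orP[/eqP<-//|]; apply: lexlt_trans. Qed.

Lemma lexle_trans b a c : lexle a b -> lexle b c -> lexle a c.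
Proof. by move=> ab /orP[/eqP<-//|bc]; apply/lexltW/(lexle_lt_trans ab). Qed.

Lemma lexlt_add2l c a b : lexlt (c + a)%MM (c + b)%MM = lexlt a b.
Proof.
apply/lexltP/lexltP => -[i]; rewrite ?mnmDE ?ltn_add2l => lt_i h; exists i => //.
- by move=> j /h; rewrite !mnmDE => /addnI.
- by rewrite !mnmDE ltn_add2l.
- by move=> j /h; rewrite !mnmDE => ->.
Qed.

Lemma lexlt1 i j : lexlt U_(i)%MM U_(j)%MM = (j < i)%N.
Proof.
apply/lexltP/idP => [[l]|ji].
  rewrite !mnm1E; case: (j =P l) => [<-|_]; last by case: (i == l).
  move=> ij h; rewrite ltnNge; apply/negP; rewrite leq_eqVlt => /orP[/eqP/val_inj e|].
    by rewrite e eqxx in ij.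
  move/h; rewrite !mnm1E eqxx => /esym/eqP; rewrite eqb1 => /eqP e.
  by rewrite e eqxx in ij.
exists j => [|l lj]; rewrite !mnm1E.
  by rewrite eqxx; case: eqP => // e; rewrite e ltnn in ji.
case: eqP => [e|_]; first by rewrite e ltnNge ltnW in ji.
by case: eqP => // e; rewrite e ltnn in lj.
Qed.

(* The relation [U_(j) + w = U_(t) + w'] says w' = x_j w / x_t. *)
Lemma exchange_lexlt w w' j t : (U_(j) + w)%MM = (U_(t) + w')%MM ->
  lexlt w' w = (t < j)%N.
Proof.
move=> e; rewrite -(lexlt_add2l U_(t)) -e ![(_ + w)%MM]addmC lexlt_add2l.
exact: lexlt1.
Qed.

Lemma exchange_exists w j t : (0 < w t)%N ->
  exists w', (U_(j) + w)%MM = (U_(t) + w')%MM.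
Proof.
move=> wt; exists (U_(j) + w - U_(t))%MM; rewrite [RHS]addmC submK // lep1mE mnmDE.
by rewrite addn_gt0 wt orbT.
Qed.

Lemma lem_mdeg_eq m m' : (m <= m')%MM -> mdeg m = mdeg m' -> m = m'.
Proof.
move=> le_m e; apply/esym; rewrite -(submK le_m); move: e.
rewrite -{1}(submK le_m) mdegD -[LHS]add0n => /addIn/esym/eqP.
by rewrite mdeg_eq0 => /eqP ->; rewrite add0m.
Qed.

(** The quotient has degree 1, hence is a variable. *)
Lemma exchange_of_divisor w w' j : (w' <= U_(j) + w)%MM -> mdeg w' = mdeg w ->
  exists t, (U_(j) + w)%MM = (U_(t) + w')%MM.
Proof.
move=> le_w' e; pose r := (U_(j) + w - w')%MM.
have rE : (r + w' = U_(j) + w)%MM by rewrite submK.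
have : mdeg r = 1%N.
  by apply/eqP; rewrite -(eqn_add2r (mdeg w')) -mdegD rE mdegD mdeg1 e.
by move=> /eqP/mdeg1P[t /eqP rt]; exists t; rewrite -rE rt.
Qed.

End Lex.

(** * The order [prec], the sets of the generators and the decomposition function *)

Section Prec.
Variable n : nat.
Implicit Types (u v w a b c : 'X_{1..n.+1}) (i j t : 'I_n.+1).

Lemma prec_irr w : prec w w = false.
Proof. by rewrite /prec ltnn lexlt_irr andbF. Qed.

Lemma prec_trans : transitive (@prec n).
Proof.
move=> b a c; rewrite /prec.
case/orP => [ab|/andP[/eqP ab ab']]; case/orP => [bc|/andP[/eqP bc bc']].
- by rewrite (ltn_trans ab bc).
- by rewrite -bc ab.
- by rewrite ab bc.
- by rewrite ab bc eqxx (lexlt_trans bc' ab') orbT.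
Qed.

Lemma preceq_refl : reflexive (@preceq n).
Proof. by move=> w; rewrite /preceq eqxx. Qed.

Lemma preceq_trans : transitive (@preceq n).
Proof.
move=> b a c; rewrite /preceq => /orP[/eqP->//|ab] /orP[/eqP<-|bc].
  by rewrite ab orbT.
by rewrite (prec_trans ab bc) orbT.
Qed.

Lemma preceq_total : total (@preceq n).
Proof.
move=> a b; rewrite /preceq /prec; case: (ltngtP (a ord0) (b ord0)) => _ /=;
  rewrite ?orbT //.
by have /or3P[->|->|->] := lexlt_total a b; rewrite ?orbT.
Qed.

Lemma preceq_prec_trans b a c : preceq a b -> prec b c -> prec a c.
Proof. by case/orP => [/eqP->//|]; apply: prec_trans. Qed.

(** For j other than x_1, taking t to be x_1 lowers the x_1-exponent; otherwise that exponent is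
    unchanged and [prec] reverses the lexicographic order. *)
Lemma exchange_prec w w' j t : (U_(j) + w)%MM = (U_(t) + w')%MM ->
  prec w' w = (j != ord0) && ((t == ord0) || (j < t)%N).
Proof.
move=> e; have /mnmP/(_ ord0) := e; rewrite !mnmDE !mnm1E /prec.
rewrite (exchange_lexlt (esym e)); have [->|j0] := eqVneq j ord0;
  have [->|t0] := eqVneq t ord0 => /=; lia.
Qed.

End Prec.

Section Lexgens.
Variables (k : fieldType) (n d : nat) (u v : 'X_{1..n.+1}).
Implicit Types (w m : 'X_{1..n.+1}) (i j t : 'I_n.+1).
Local Notation L := (lexseg d u v).
Local Notation ws := (lexgens d u v).

Lemma mem_lexgens w : (w \in ws) = (w \in L).
Proof. by rewrite mem_sort. Qed.

Lemma mdeg_lexseg w : w \in L -> mdeg w = d.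
Proof. by rewrite mem_lexseg => /and3P[/eqP]. Qed.

Lemma lexgens_sorted : sorted (@preceq n) ws.
Proof. exact: sort_sorted (@preceq_total n) _. Qed.

Lemma mem_take_lexgens w w' : w \in ws ->
  (w' \in take (index w ws) ws) = (w' \in ws) && prec w' w.
Proof.
move=> w_ws; have [w'_ws|w'_ws] := boolP (w' \in ws); last first.
  by apply/negbTE; apply: contra w'_ws; exact: mem_take.
rewrite in_take_leq ?index_size //.
have mono := sorted_ltn_index (@preceq_trans n) lexgens_sorted.
case: (ltngtP (index w' ws) (index w ws)) => [lt_w'w|lt_ww'|/index_inj e].
- have := mono _ _ w'_ws w_ws lt_w'w; case/orP => [/eqP e|->//].
  by rewrite e ltnn in lt_w'w.
- have le_ww' := mono _ _ w_ws w'_ws lt_ww'; apply/esym/negbTE/negP => w'w.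
  by have := preceq_prec_trans le_ww' w'w; rewrite prec_irr.
- by rewrite e // prec_irr.
Qed.

(** A monomial lies in a monomial ideal iff a generator divides it; here the generators are those
    preceding [w], and equal degrees turn divisibility into an exchange. *)
Lemma in_setw_lexgens w j : w \in L ->
  reflect (j != ord0 /\ exists t w', [/\ w' \in L,
             (U_(j) + w)%MM = (U_(t) + w')%MM & (t == ord0) || (j < t)%N])
    (j \in setw k ws w).
Proof.
move=> wL; have w_ws : w \in ws by rewrite mem_lexgens.
rewrite inE; apply: (iffP (asboolP _)); rewrite /colon -mpolyXD.
  move=> /mon_idealXE/hasP[w']; rewrite mem_take_lexgens // mem_lexgens.
  move=> /andP[w'L w'w] /exchange_of_divisor.
  rewrite (mdeg_lexseg w'L) (mdeg_lexseg wL) => /(_ erefl)[t tE].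
  move: w'w; rewrite (exchange_prec tE) => /andP[j0 tj]; split=> //.
  by exists t, w'.
case=> j0 [t [w' [w'L tE tj]]]; apply/mon_idealXE/hasP; exists w'.
  by rewrite mem_take_lexgens // mem_lexgens w'L (exchange_prec tE) j0.
by rewrite tE lem_addl.
Qed.

(** The first prefix whose ideal contains m ends at the first generator dividing m, which is the
    least one for [prec] since the list is sorted. *)
Lemma decomposition_lexgens m : has (fun g => (g <= m)%MM) L ->
  [/\ decomposition k ws m \in L, (decomposition k ws m <= m)%MM &
    forall g, g \in L -> (g <= m)%MM -> preceq (decomposition k ws m) g].
Proof.
move=> hasL; pose a g := (g <= m)%MM.
have has_ws : has a ws.
  by case/hasP: hasL => g gL gm; apply/hasP; exists g; rewrite ?mem_lexgens.
have -> : decomposition k ws m = nth 0%MM ws (find a ws).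
  rewrite /decomposition; congr nth.
  have predE c : (c \in iota 0 (size ws)) ->
      `[< mon_ideal (take c.+1 ws) ('X_[m] : {mpoly k[n.+1]}) >]
      = (find a ws <= c)%N.
    rewrite mem_iota add0n => /= c_lt; rewrite -ltnS -has_take //.
    by apply/asboolP/idP => [/mon_idealXE|]; [|move=> ?; apply/mon_idealXE].
  have f_lt : (find a ws < size ws)%N by rewrite -has_find.
  rewrite (eq_in_find predE).
  have hasf : has (fun c => (find a ws <= c)%N) (iota 0 (size ws)).
    by apply/hasP; exists (find a ws); rewrite // mem_iota.
  have := hasf; rewrite has_find size_iota => lt_size.
  apply/eqP; rewrite eqn_leq; apply/andP; split.
    rewrite leqNgt; apply/negP => /(before_find 0%N).
    by rewrite nth_iota // add0n leqnn.
  by have := nth_find 0%N hasf; rewrite nth_iota.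
have nthL : nth 0%MM ws (find a ws) \in ws by rewrite mem_nth // -has_find.
split; first by rewrite -mem_lexgens.
  exact: (nth_find 0%MM has_ws).
move=> g; rewrite -mem_lexgens => g_ws gm.
have le_fg : (find a ws <= index g ws)%N.
  rewrite leqNgt; apply/negP => /(before_find 0%MM).
  by rewrite nth_index // /a gm.
rewrite -(nth_index 0%MM g_ws).
apply: (sorted_leq_nth (@preceq_trans n) (@preceq_refl n) 0%MM lexgens_sorted) => //.
  by rewrite inE -has_find.
by rewrite inE index_mem.
Qed.

(** Write x_s w = x_r g and x_j g = x_l h. If j precedes no variable of w, the generator sought is
    x_j w / x_1, and the cases on l and r bound it below. *)
Lemma regular_of_exchange :
  (forall w j t, w \in L -> j != ord0 -> (j < t)%N -> (0 < w t)%N ->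
    j \in setw k ws w) -> regular_decomposition k ws.
Proof.
move=> exch w; rewrite mem_lexgens => wL s /(in_setw_lexgens _ wL).
case=> s0 [t0 [w0 [w0L w0E w0t]]].
have [|gL g_div g_min] := @decomposition_lexgens (U_(s) + w)%MM.
  by apply/hasP; exists w0; rewrite // w0E lem_addl.
set g := decomposition _ _ _ in gL g_div g_min *.
have [r rE] := exchange_of_divisor g_div (etrans (mdeg_lexseg gL) (esym (mdeg_lexseg wL))).
have : prec g w.
  apply: preceq_prec_trans (g_min _ w0L _) _; first by rewrite w0E lem_addl.
  by rewrite (exchange_prec w0E) s0.
rewrite (exchange_prec rE) s0 /= => r_cases.
apply/subsetP => j /(in_setw_lexgens _ gL)[j0 [l [h [hL hE l_cases]]]].
have [/existsP[t /andP[jt wt]]|nlarge] := boolP [exists t : 'I_n.+1, (j < t)%N && (0 < w t)%N].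
  exact: exch wt.
have w_small (t : 'I_n.+1) : (j < t)%N -> w t = 0%N.
  move=> jt; apply/eqP; rewrite -leqn0 leqNgt; apply: contra nlarge => wt.
  by apply/existsP; exists t; rewrite jt.
have ltL w' : lexlt w' w -> lexle w' u.
  move=> /lexltW le_w'; move: wL; rewrite mem_lexseg => /and3P[_ _].
  exact: lexle_trans.
(* Being smaller than [w], the monomial x_j w / x_1 can leave the segment only below [v]. *)
have to_setw w' : (U_(j) + w)%MM = (U_(ord0) + w')%MM -> lexle v w' ->
    j \in setw k ws w.
  move=> w'E vw'; apply/in_setw_lexgens => //; split=> //; exists ord0, w'.
  split=> //; rewrite mem_lexseg vw' ltL ?andbT.
    have /(congr1 mdeg) := w'E; rewrite !mdegD !mdeg1 (mdeg_lexseg wL).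
    by move=> /addnI ->.
  by rewrite (exchange_lexlt w'E) lt0n.
have vge w' : w' \in L -> lexle v w' by rewrite mem_lexseg => /and3P[].
have coord (i1 i2 : 'I_n.+1) a b i : (U_(i1) + a)%MM = (U_(i2) + b)%MM ->
    ((i1 == i) + a i = (i2 == i) + b i)%N.
  by move=> /mnmP/(_ i); rewrite !mnmDE !mnm1E.
(* If l is not x_1, then x_l divides g but not w, which forces s = l and r = x_1; then x_j w / x_1 =
   x_j g / x_s > g since j < s. *)
have [l0|l0] := eqVneq l ord0; last first.
  move: l_cases; rewrite (negPf l0) /= => jl.
  have gl : (0 < g l)%N.
    have := coord _ _ _ _ l hE; rewrite eqxx.
    have -> : (j == l) = false by apply: contraTF jl => /eqP ->; rewrite ltnn.
    by rewrite add0n => ->.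
  have sl : s = l.
    have := coord _ _ _ _ l rE; rewrite (w_small _ jl) addn0.
    by case: eqP => // _ /= e; move: gl; rewrite ltnNge (leq_trans _ (eq_leq (esym e))) ?leq_addl.
  have r0 : r = ord0.
    case: eqP r_cases => // _ /= sr; have := coord _ _ _ _ r rE.
    rewrite (w_small r) ?eqxx; last by rewrite (ltn_trans jl) // -sl.
    by have -> : (s == r) = false by apply: contraTF sr => /eqP ->; rewrite ltnn.
  have w_0 : (0 < w ord0)%N.
    by have := coord _ _ _ _ ord0 rE; rewrite r0 (negPf s0) eqxx add0n => ->.
  have [w' w'E] := exchange_exists j w_0.
  apply: (to_setw _ w'E); apply: lexle_trans (vge _ gL) _.
  apply: lexltW; have e : (U_(j) + g)%MM = (U_(s) + w')%MM.
    apply: (@addmI _ U_(ord0)%MM); rewrite addmCA [RHS]addmCA -w'E -r0 -rE.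
    by rewrite addmCA.
  by rewrite (exchange_lexlt (esym e)) sl.
have w_0 : (0 < w ord0)%N.
  have := coord _ _ _ _ ord0 rE; have := coord _ _ _ _ ord0 hE.
  rewrite l0 (negPf j0) (negPf s0) eqxx !add0n => -> ->.
  by rewrite addnA addn_gt0 addn_gt0 orbT.
have [w' w'E] := exchange_exists j w_0.
apply: (to_setw _ w'E); rewrite l0 in hE.
(* If r is x_1, then x_j w / x_1 = x_1 h / x_s > h. *)
case: (eqVneq r ord0) r_cases => [r0 _|r0 /= sr].
  have e : (U_(s) + w')%MM = (U_(ord0) + h)%MM.
    apply: (@addmI _ U_(ord0)%MM); rewrite -hE addmCA -w'E addmCA rE r0.
    by rewrite addmCA.
  apply: lexle_trans (vge _ hL) (lexltW _).
  by rewrite (exchange_lexlt e) lt0n.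
(* The remaining case is contradictory: [w2] = x_s w / x_1 is at least [h], so it is a generator
   dividing x_s w, and its x_1-exponent is smaller than that of g. *)
have rj : (r <= j)%N.
  rewrite leqNgt; apply/negP => /w_small wr; have := coord _ _ _ _ r rE.
  have -> : (s == r) = false by apply: contraTF sr => /eqP ->; rewrite ltnn.
  by rewrite wr eqxx.
have [w2 w2E] := exchange_exists s w_0.
have e : (U_(j) + w2)%MM = (U_(r) + h)%MM.
  by apply: (@addmI _ U_(ord0)%MM); rewrite addmCA -w2E rE [RHS]addmCA -hE addmCA.
have hw2 : lexle h w2.
  move: rj; rewrite leq_eqVlt => /orP[/eqP/val_inj rj|rj].
    by move: e; rewrite rj => /addmI ->; rewrite /lexle eqxx.
  by apply: lexltW; rewrite (exchange_lexlt e).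
have w2L : w2 \in L.
  rewrite mem_lexseg (lexle_trans (vge _ hL) hw2) ltL ?andbT.
    have /(congr1 mdeg) := w2E; rewrite !mdegD !mdeg1 (mdeg_lexseg wL).
    by move=> /addnI ->.
  by rewrite (exchange_lexlt w2E) lt0n.
have w2g : prec w2 g.
  have := coord _ _ _ _ ord0 rE; have := coord _ _ _ _ ord0 w2E.
  by rewrite /prec (negPf s0) (negPf r0) eqxx !add0n => -> <-; rewrite ltnSn.
have : prec g g.
  by apply: preceq_prec_trans w2g; apply: g_min w2L _; rewrite w2E lem_addl.
by rewrite prec_irr.
Qed.

End Lexgens.

(** * Consequences of a linear resolution *)

Section LinearResolution.
Variables (k : fieldType) (n d : nat) (u v : 'X_{1..n.+1}).
Local Notation S := {mpoly k[n.+1]}.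
Local Notation L := (lexseg d u v).
Hypotheses (d_gt0 : (0 < d)%N) (u_deg : mdeg u = d) (v_deg : mdeg v = d).
Implicit Types (w y m : 'X_{1..n.+1}) (i j t : 'I_n.+1).

(** Only the full set lies above a facet, so the single polynomial [g setT] links the coefficients
    on different facets. *)
Lemma mcoeff_kosz_setC1 (g : {set 'I_n.+1} -> S) i m :
  (kosz g (~: [set i]))@_(U_(i) + m) =
  (-1) ^+ ksgn i (~: [set i]) * (g setT)@_m.
Proof.
rewrite /kosz (bigD1 i) /=; last by rewrite !inE eqxx.
rewrite big1 ?addr0 => [|j /andP[]]; last first.
  by rewrite !inE negbK => /eqP ->; rewrite eqxx.
have -> : i |: ~: [set i] = setT by rewrite setUCr.
have signE a (p : S) m' : ((-1) ^+ a * p)@_m' = (-1) ^+ a * p@_m'.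
  rewrite -(signr_odd S) -(signr_odd k); case: (odd a).
    by rewrite !expr1 !mulN1r mcoeffN.
  by rewrite !expr0 !mul1r.
by rewrite signE mulrC addmC [_ * g _]mulrC addmC mcoeffMX mulrC.
Qed.

Lemma no_linear_resolution m t :
  linear_resolution (@mon_ideal k n.+1 L) d ->
  t != ord0 -> mdeg (U_(ord0) + m) = d ->
  (U_(ord0) + m)%MM \notin L -> (U_(t) + m)%MM \notin L ->
  (forall i, i != ord0 -> has (fun g => (g <= U_(i) + (U_(ord0) + m))%MM) L) ->
  False.
Proof.
move=> hlin t0 m_deg yL zL hasL; set y := (U_(ord0) + m)%MM in m_deg yL hasL.
pose top i : {set 'I_n.+1} := ~: [set i].
(* The Koszul chain x_1 m e_{2..n}. *)
pose c s : S := if s == top ord0 then 'X_[y] else 0.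
have n_gt0 : (0 < n)%N.
  by rewrite -ltnS (leq_ltn_trans _ (ltn_ord t)) // lt0n.
have kc_I s : mon_ideal L (kosz c s).
  rewrite /kosz; elim/big_rec: _ => [|i p i_s pI]; first exact: mon_ideal0.
  apply: mon_idealD pI; apply: mon_idealM; rewrite /c; case: eqP => [e|_].
    rewrite -mpolyXD; apply: mon_idealX; apply: hasL.
    by have := setU11 i s; rewrite e !inE.
  by rewrite mulr0; apply: mon_ideal0.
(* [c] has exterior degree n and internal degree d + n; as Tor index n - 1 this is j = d + 1, off
   the linear strand. *)
have tor : tor_vanishes (@mon_ideal k n.+1 L) n.-1 (n.-1%:Z + d.+1%:Z).
  by apply: hlin; rewrite eqz_nat; lia.
have [s m'|//|w wI wE] := kosz_tor_vanishes (c := c) tor.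
  rewrite /c; case: eqP => [->|_]; last by rewrite msupp0.
  rewrite msuppX mem_seq1 => /eqP ->; rewrite m_deg cardsC1 card_ord.
  by split; lia.
(* In degree d the monomials of the ideal are exactly those of [L]. *)
have wL s x : mdeg x = d -> x \notin L -> (w s)@_x = 0.
  move=> x_deg xL; apply: memN_msupp_eq0; apply: contra xL.
  move=> /(msupp_mon_ideal (wI s))/hasP[g gL gx].
  by rewrite -(lem_mdeg_eq gx) // (mdeg_lexseg gL).
have [s||g gE] := kosz_exact (f := fun s => c s - w s).
- by rewrite koszB wE subrr.
(* No constant term at the empty set: [top ord0] contains [t], and the ideal is generated in
   positive degree. *)
- rewrite mcoeffB /c ifF ?mcoeff0 ?sub0r; last first.
    by apply/negbTE/eqP => /setP/(_ t); rewrite !inE t0.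
  rewrite (@memN_msupp_eq0 _ _ (w set0)) ?oppr0 //; apply/negP.
  move=> /(msupp_mon_ideal (wI _))/hasP[x xL /mnm_lepP x0].
  have x_eq0 : x = 0%MM.
    by apply/mnmP => i; have := x0 i; rewrite mnm0E leqn0 => /eqP.
  by have := d_gt0; rewrite -(mdeg_lexseg xL) x_eq0 mdeg0.
(* The facet missing x_t forces the coefficient of m in [g setT] to be 0; the facet missing x_1 then
   gives 1 = 0. *)
have := congr1 (mcoeff (U_(t) + m)) (gE (top t)).
rewrite mcoeff_kosz_setC1 mcoeffB wL //; last first.
  by move: m_deg; rewrite !mdegD !mdeg1.
rewrite /c ifF ?mcoeff0 ?subr0; last first.
  by apply/negbTE/eqP => /setP/(_ t); rewrite !inE eqxx t0.
move/esym/eqP; rewrite mulf_eq0 signr_eq0 /= => /eqP g0.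
have := congr1 (mcoeff y) (gE (top ord0)).
rewrite mcoeff_kosz_setC1 mcoeffB wL // g0 mulr0 /c eqxx mcoeffX eqxx subr0.
by move/eqP; rewrite oner_eq0.
Qed.

Lemma exchange_of_linear_resolution w j t :
  completely_lexsegment d u v ->
  linear_resolution (@mon_ideal k n.+1 L) d ->
  w \in L -> j != ord0 -> (j < t)%N -> (0 < w t)%N ->
  j \in setw k (lexgens d u v) w.
Proof.
move=> hcompl hlin wL j0 jt wt; apply: contraT => noexch.
have w_deg := mdeg_lexseg wL.
have t0 : t != ord0 by apply: contraTneq jt => ->; rewrite ltn0.
have noL i x : (U_(j) + w)%MM = (U_(i) + x)%MM -> (i == ord0) || (j < i)%N ->
    mdeg x = d /\ x \notin L.
  move=> xE ij; split.
    by have /(congr1 mdeg) := xE; rewrite !mdegD !mdeg1 w_deg => /addnI.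
  by apply: contra noexch => xL; apply/in_setw_lexgens => //; split=> //; exists i, x.
have [y yE] := exchange_exists j wt.
have [y_deg yL] := noL _ _ yE (introT orP (or_intror jt)).
have wy : lexlt w y by rewrite (exchange_lexlt (esym yE)).
move: (wL); rewrite mem_lexseg => /and3P[_ vw wu].
have vy : lexlt v y := lexle_lt_trans vw wy.
(* Since [y] has degree d and exceeds [v], it can miss the segment only by exceeding [u]. *)
have uy : lexlt u y.
  by rewrite lexltNge; apply: contra yL; rewrite mem_lexseg y_deg eqxx (lexltW vy).
have le0 (a b : 'X_{1..n.+1}) : lexle a b -> (a ord0 <= b ord0)%N.
  case/orP => [/eqP->//|/lexltP[i lt_i eq_i]].
  have [i0|i_gt0] := posnP i; last by rewrite (eq_i ord0).
  have -> : ord0 = i by exact: val_inj.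
  exact: ltnW.
have y0 : y ord0 = w ord0.
  by have /mnmP/(_ ord0) := yE; rewrite !mnmDE !mnm1E (negPf j0) (negPf t0).
have u0 : u ord0 = w ord0.
  by apply/eqP; rewrite eqn_leq (le0 _ _ wu) andbT -y0 (le0 _ _ (lexltW uy)).
(* x_i y lies between x_i v and x_1 u, both in the shadow, which is a lexsegment; the upper bound is
   already visible on the x_1-exponents. *)
have hasS i : i != ord0 -> exists2 h, h \in L & exists l, (U_(i) + y)%MM = (U_(l) + h)%MM.
  move=> i0; have [u' [v' [_ _ shE]]] := hcompl 1%N.
  have inS (a : 'X_{1..n.+1}) l : a \in L -> (U_(l) + a)%MM \in iter 1 (@shadow n.+1) L.
    by move=> aL; apply/allpairsP; exists (a, l); rewrite aL mem_enum.
  have uL : u \in L by rewrite mem_lexseg u_deg eqxx (lexle_trans vw wu) /lexle eqxx.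
  have vL : v \in L by rewrite mem_lexseg v_deg eqxx (lexle_trans vw wu) /lexle eqxx.
  have := inS _ ord0 uL; rewrite shE mem_lexseg => /and3P[_ _ u_le].
  have := inS _ i vL; rewrite shE mem_lexseg => /and3P[_ v_ge _].
  have : (U_(i) + y)%MM \in iter 1 (@shadow n.+1) L.
    rewrite shE mem_lexseg mdegD mdeg1 y_deg addnC eqxx /=.
    apply/andP; split.
      by apply: lexle_trans v_ge _; rewrite lexltW // lexlt_add2l.
    apply: lexle_trans u_le; apply/lexltW/lexltP; exists ord0 => //.
    by rewrite !mnmDE !mnm1E (negPf i0) eqxx add0n add1n y0 u0.
  by case/allpairsP => -[h l] /= [hL _ ->]; exists h => //; exists l.
have v0_neq : v ord0 != w ord0.
  apply/eqP => v0; have n_gt1 : (1 < n.+1)%N.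
    by rewrite (leq_ltn_trans _ (ltn_ord j)) // lt0n.
  (* Index 1 is x_2. If l is x_1, then [h] has a smaller x_1-exponent than [v]; otherwise h >= y >
     u. *)
  have [h hL [l lE]] := hasS (Ordinal n_gt1) isT.
  move: hL; rewrite mem_lexseg => /and3P[_ vh hu].
  have [l0|l0] := eqVneq l ord0.
    have /mnmP/(_ ord0) := lE; rewrite !mnmDE !mnm1E l0 eqxx y0 -v0 /= => e.
    by have := le0 _ _ vh; rewrite -[leqLHS]add0n e add1n ltnn.
  have := lexlt_le_trans (lexle_lt_trans hu uy) (_ : lexle y y).
  by rewrite (exchange_lexlt lE) /lexle eqxx ltnNge lt0n l0 => /(_ isT).
have w_0 : (0 < w ord0)%N.
  by rewrite lt0n; apply: contra v0_neq => /eqP w0; have := le0 _ _ vw; rewrite w0 leqn0.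
have [m yE'] : exists m, y = (U_(ord0) + m)%MM.
  by exists (y - U_(ord0))%MM; rewrite addmC submK // lep1mE y0.
(* x_t m is x_j w / x_1, which is outside [L] because j is not in set(w). *)
have zE : (U_(j) + w = U_(ord0) + (U_(t) + m))%MM by rewrite yE yE' addmCA.
have [_ zL] := noL _ _ zE isT.
exfalso; apply: (no_linear_resolution hlin t0) (zL) _; rewrite -?yE' //.
move=> i /hasS[h hL [l lE]]; apply/hasP; exists h => //.
by rewrite lE lem_addl.
Qed.

End LinearResolution.

Theorem theorem2p1p6 (k : fieldType) (n d : nat) (u v : 'X_{1..n.+1})
    (hd : (2 <= d)%N) (hu : mdeg u = d) (hv : mdeg v = d) (huv : lexle v u)
    (hcompl : completely_lexsegment d u v)
    (hlin : linear_resolution (@mon_ideal k n.+1 (lexseg d u v)) d) :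
  regular_decomposition k (lexgens d u v).
Proof.
apply: regular_of_exchange => w j t.
exact: (exchange_of_linear_resolution (ltnW hd) hu hv hcompl hlin).
Qed.
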